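(* Let $p$ be a prime. For a partition $\lambda$ of a natural number (including the empty partition), let $\mu=\lambda'$ be its transpose (so $\mu_i$ is the number of parts of $\lambda$ of size at least $i$), and set \[ \pi(\lambda)=\frac{\prod_{i \text{ odd},\, i\ge 1} (1-1/p^i)}{p^{\sum_i \mu_i(\mu_i+1)/2} \prod_{i=1}^{\lambda_1} \prod_{j=1}^{\lfloor (\mu_i - \mu_{i+1})/2 \rfloor}(1-1/p^{2j})}. \] Then $\pi$ is a probability measure on the set of all partitions of all natural numbers, and if $\lambda$ is chosen according to $\pi$, then for every integer $n\ge 0$ the probability that $|\lambda|=n$ equals \[ \frac{ \prod_{i \text{ odd}} (1-1/p^i)}{p^n} \sum_{\substack{j=0\\ j \text{ even}}}^n \frac{1}{p^{j/2} (1-1/p^2) (1-1/p^4) \cdots (1-1/p^j)} , \] where the $j=0$ term of the sum is $1$.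
   Context: $|\lambda|$ denotes the size (sum of parts) of $\lambda$; $\lambda_1$ is the largest part. Empty products are $1$, and $\mu_{\lambda_1+1}=0$. *)

(* Defs.v *)
From HB Require Import structures.
From mathcomp Require Import all_boot all_order all_algebra.
From mathcomp Require Import all_classical all_reals all_analysis.

Set Implicit Arguments.
Unset Strict Implicit.
Unset Printing Implicit Defensive.

Import Order.TTheory GRing.Theory Num.Theory.
Import numFieldNormedType.Exports.
Local Open Scope classical_set_scope.
Local Open Scope ring_scope.

(* A partition is the weakly decreasing sequence of its positive parts;
   [::] is the empty partition. *)
Definition is_intpart (s : seq nat) : bool := sorted geq s && (0%N \notin s).

Record intpart := IntPart { parts :> seq nat; _ : is_intpart parts }.

HB.instance Definition _ := [isSub for parts].
HB.instance Definition _ := [Countable of intpart by <:].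

Definition empty_intpart : intpart := @IntPart [::] isT.

HB.instance Definition _ := isPointed.Build intpart empty_intpart.

HB.instance Definition _ := @isMeasurable.Build default_measure_display
  intpart discrete_measurable discrete_measurable0
  discrete_measurableC discrete_measurableU.

Definition psize (l : intpart) : nat := sumn l.

Definition largest_part (l : intpart) : nat := head 0%N l.

(* The i-th part (i >= 1) of the transpose of l; it is 0 for
   i > largest_part l. *)
Definition transpose_part (l : intpart) (i : nat) : nat :=
  count (fun x => i <= x)%N l.

(* The product over odd i >= 1 of (1 - 1/p^i), as the limit of its partial
   products; is_cvg_odd_partial_prod below shows that the limit exists. *)
Definition odd_partial_prod (R : realType) (p n : nat) : R :=
  \prod_(1 <= i < n | odd i) (1 - 1 / p%:R ^+ i).

Definition odd_prod (R : realType) (p : nat) : R :=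
  limn (odd_partial_prod R p).

(* The subtraction and both divisions by 2 are those of nat: the transpose is
   weakly decreasing and m (m + 1) is even, so only the floor in the range of j
   rounds. *)
Definition pi_part (R : realType) (p : nat) (l : intpart) : R :=
  let mu := transpose_part l in
  odd_prod R p /
  (p%:R ^+ (\sum_(1 <= i < (largest_part l).+1) (mu i * (mu i).+1) %/ 2)%N
   * \prod_(1 <= i < (largest_part l).+1)
       \prod_(1 <= j < ((mu i - mu i.+1) %/ 2).+1)
         (1 - 1 / p%:R ^+ (2 * j))).

Lemma is_cvg_odd_partial_prod (R : realType) (p : nat) :
  prime p -> cvgn (odd_partial_prod R p).
Proof.
move=> /prime_gt0 p0.
have f0 i : 0 <= 1 - 1 / p%:R ^+ i :> R.
  rewrite subr_ge0 div1r invf_le1 ?exprn_gt0 ?ltr0n//.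
  by rewrite exprn_ege1// ler1n.
apply: nonincreasing_is_cvgn.
  apply/nonincreasing_seqP => -[|n]; rewrite /odd_partial_prod.
    by rewrite !big_geq.
  rewrite big_mkcond [leRHS]big_mkcond big_nat_recr//= ler_piMr//.
    by rewrite prodr_ge0// => i _; case: ifP.
  by case: ifP => // _; rewrite gerBl divr_ge0// exprn_ge0.
by exists 0 => _ [n _ <-]; exact: prodr_ge0.
Qed.

(* Main.v *)
Require Import Defs.
From HB Require Import structures.
From mathcomp Require Import all_boot all_order all_algebra.
From mathcomp Require Import all_classical all_reals all_analysis.
From mathcomp Require Import qpoly ring lra zify.

(** Put [t = 1/p] and [q = t^2], and let [F_k(u)] be the generating function, by
    size, of the unnormalised weights of the partitions with exactly [k] parts.
    Removing the first column of the Young diagram gives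
      [F_k = u^k t^(k(k+1)/2) * sum_(l <= k) F_l / (q;q)_((k-l)/2)],
    which determines the [F_k] from [F_0 = 1].  With [z = u^2 t^3] and
      [G_j = z^j q^(j(j-1)) / ((1 - u t) (q;q)_j (z;q)_j)]
    the solution is [F_(2j) = (1 - u t^(2j+1)) G_j], [F_(2j+1) = u t^(2j+1) G_j];
    this is the q-Chu-Vandermonde identity
      [sum_j [m,j]_q z^j q^(j(j-1)) / (z;q)_j = 1 / (z;q)_m].
    Since also [1 / (z;q)_(m+1) = sum_r [m+r,r]_q z^r], letting [m] tend to infinity
    in the coefficient of [u^n] turns [sum_k F_k = sum_j G_j] into
      [(1 - u t)^-1 * sum_r z^r / (q;q)_r],
    which is the law of the size.  The total mass is then a case of Euler's identity
    [sum_r z^r / (q;q)_r = 1 / (z;q)_oo], obtained by iterating the functional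
    equation [e(z) (1 - z) = e(z q)].

    Power series in [u] are computed modulo [u^(n+1)], in [{poly %/ 'X^(n.+1)}]. *)

Import Order.TTheory GRing.Theory Num.Theory.
Import numFieldNormedType.Exports.

Set Implicit Arguments.
Unset Strict Implicit.
Unset Printing Implicit Defensive.

Local Open Scope classical_set_scope.
Local Open Scope ring_scope.


(** * q-series identities *)

(** The q-Pochhammer symbol [(z;q)_n], with the base as first argument. *)
Definition qpoch (A : comNzRingType) (q z : A) (n : nat) : A :=
  \prod_(i < n) (1 - z * q ^+ i).

(** The Gaussian binomial, defined by Pascal's rule so that no division occurs. The truncated
    exponent [m' - j'] is harmless: for [m' < j'] it multiplies a zero coefficient. *)
Fixpoint qbin (A : comNzRingType) (q : A) (m j : nat) : A :=
  match m, j with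
  | _, 0 => 1
  | 0, _.+1 => 0
  | m'.+1, j'.+1 => qbin q m' j'.+1 + q ^+ (m' - j') * qbin q m' j'
  end.
Arguments qbin : simpl never.

Section QIdentities.
Variable A : comUnitRingType.
Implicit Types q z : A.

Lemma qpoch0 q z : qpoch q z 0 = 1.
Proof. by rewrite /qpoch big_ord0. Qed.

Lemma qpochSr q z n : qpoch q z n.+1 = qpoch q z n * (1 - z * q ^+ n).
Proof. by rewrite /qpoch big_ord_recr. Qed.

Lemma qpochSl q z n : qpoch q z n.+1 = (1 - z) * qpoch q (z * q) n.
Proof.
rewrite /qpoch big_ord_recl expr0 mulr1; congr (_ * _).
by apply: eq_bigr => i _; rewrite -mulrA -exprS.
Qed.

Lemma unitr_qpoch q z n :
  (forall i, 1 - z * q ^+ i \is a GRing.unit) -> qpoch q z n \is a GRing.unit.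
Proof. by move=> zU; apply: rpred_prod => i _; exact: zU. Qed.

Lemma qbin0 q m : qbin q m 0 = 1.
Proof. by case: m. Qed.

Lemma qbinS q m j :
  qbin q m.+1 j.+1 = qbin q m j.+1 + q ^+ (m - j) * qbin q m j.
Proof. by []. Qed.

Lemma qbin_small q m j : (m < j)%N -> qbin q m j = 0.
Proof.
by elim: m j => [|m IH] [|j] // mj; rewrite qbinS !IH ?mulr0 ?addr0 // ltnW.
Qed.

Lemma qbinn q m : qbin q m m = 1.
Proof. by elim: m => // m IH; rewrite qbinS qbin_small// subnn IH add0r mulr1. Qed.

(** Factorial formula, with denominators cleared. Induction on [m + j] through Pascal's rule and [1
    - q^(m+j+2) = (1 - q^(m+1)) + q^(m+1) (1 - q^(j+1))]. *)
Lemma qbin_qpoch q m j :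
  qbin q (m + j) j * (qpoch q q j * qpoch q q m) = qpoch q q (m + j).
Proof.
move: {2}(m + j)%N (erefl (m + j)%N) => s; elim: s m j => [|s IH] m j.
  by move/eqP; rewrite addn_eq0 => /andP[/eqP-> /eqP->]; rewrite qbin0 qpoch0 !mulr1.
case: j => [|j]; first by rewrite addn0 qbin0 qpoch0 !mul1r.
case: m => [|m] /eqP; rewrite addnS eqSS => /eqP E.
  by rewrite add0n qbinn qpoch0 mulr1 mul1r.
have IH1 := IH m j.+1 _; rewrite addnS -addSn in IH1; have {}IH1 := IH1 E.
have IH2 := IH m.+1 j E.
rewrite qbinS addnK [qpoch _ _ (_ + _).+1]qpochSr.
rewrite mulrDl [X in X + _](_ : _ = qpoch q q (m.+1 + j) * (1 - q * q ^+ m)).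
  rewrite [X in _ + X](_ : _ =
    qpoch q q (m.+1 + j) * (q ^+ m.+1 * (1 - q * q ^+ j))); first last.
    by rewrite -IH2 [qpoch q q j.+1]qpochSr; ring.
  by rewrite exprD exprS; ring.
by rewrite -IH1 [qpoch q q m.+1]qpochSr; ring.
Qed.

(** Pascal's rule splits the sum for [m + 1] into the sum for [m] at [z] and [z q^m / (1 - z)] times
    the sum for [m] at [z q]. The two inverses add up because [(1 - z q^m) + z q^m = 1]. *)
Lemma qchu_vandermonde q z m :
  (forall i, 1 - z * q ^+ i \is a GRing.unit) ->
  \sum_(j < m.+1) qbin q m j * (z ^+ j * q ^+ (j * j.-1) / qpoch q z j)
    = (qpoch q z m)^-1.
Proof.
elim: m z => [|m IH] z zU.
  by rewrite big_ord1 /= qbin0 !expr0 !qpoch0 !mul1r.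
have zqU i : 1 - z * q * q ^+ i \is a GRing.unit.
  by rewrite -mulrA -exprS; exact: zU.
have z1U : 1 - z \is a GRing.unit by have := zU 0; rewrite expr0 mulr1.
rewrite big_ord_recl qbin0.
under eq_bigr => j _ do rewrite lift0 qbinS mulrDl.
rewrite big_split /= addrA.
have -> : 1 * (z ^+ 0 * q ^+ (0 * 0.-1) / qpoch q z 0) +
   \sum_(i < m.+1) qbin q m i.+1 * (z ^+ i.+1 * q ^+ (i.+1 * i) / qpoch q z i.+1)
   = (qpoch q z m)^-1.
  rewrite -(IH z zU) [RHS]big_ord_recl qbin0; congr (_ + _).
  by rewrite big_ord_recr /= qbin_small// mul0r addr0.
have -> : \sum_(i < m.+1) q ^+ (m - i) * qbin q m i *
    (z ^+ i.+1 * q ^+ (i.+1 * i) / qpoch q z i.+1) =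
    z * q ^+ m / (1 - z) * (qpoch q (z * q) m)^-1.
  rewrite -(IH _ zqU) mulr_sumr; apply: eq_bigr => i _.
  have im : (i <= m)%N by rewrite -ltnS.
  rewrite qpochSl invrM ?unitr_qpoch//.
  have -> : q ^+ (m - i) * qbin q m i *
     (z ^+ i.+1 * q ^+ (i.+1 * i) * ((qpoch q (z * q) i)^-1 / (1 - z))) =
     qbin q m i * z ^+ i.+1 * q ^+ (m - i + i.+1 * i) / qpoch q (z * q) i / (1 - z).
    by rewrite exprD; ring.
  (* One factor [q^i] is set aside to turn [z^i] into [(z q)^i]. *)
  have -> : (m - i + i.+1 * i = m + i + i * i.-1)%N.
    by case: (i : nat) im => [|k]; nia.
  by rewrite !exprD exprMn exprS; ring.
rewrite -[_ / (1 - z) * _]mulrA -invrM ?unitr_qpoch// mulrC.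
have -> : qpoch q (z * q) m * (1 - z) = qpoch q z m.+1 by rewrite qpochSl mulrC.
rewrite qpochSr invrM ?unitr_qpoch// -{1}[(qpoch q z m)^-1](mulKr (zU m)).
by rewrite mulrCA; ring.
Qed.

Lemma sum_expr_nilpotent z M : z ^+ M = 0 -> (1 - z) * (\sum_(r < M) z ^+ r) = 1.
Proof. by move=> zM; rewrite -opprB mulNr -subrX1 zM sub0r opprK. Qed.

Lemma unitr_1B_nilpotent z M : z ^+ M = 0 -> 1 - z \is a GRing.unit.
Proof.
by move=> /sum_expr_nilpotent zM; apply/unitrPr; exists (\sum_(r < M) z ^+ r).
Qed.

(** Nilpotency truncates the q-binomial series to a finite sum. Induction on [m]: multiplication by
    the new factor [1 - z q^(m+1)] must give back the previous sum. *)
Lemma inv_qpoch_nilpotent q z M m : z ^+ M = 0 ->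
  (qpoch q z m.+1)^-1 = \sum_(r < M) qbin q (m + r) r * z ^+ r.
Proof.
move=> zM.
have zU i : 1 - z * q ^+ i \is a GRing.unit.
  by apply: (@unitr_1B_nilpotent _ M); rewrite exprMn zM mul0r.
apply: (mulrI (unitr_qpoch m.+1 zU)); rewrite divrr ?unitr_qpoch//.
case: M zM => [|M] zM.
  by rewrite big_ord0 mulr0; move: zM; rewrite expr0.
elim: m => [|m IH].
  rewrite qpochSr qpoch0 mul1r expr0 mulr1 -[LHS](sum_expr_nilpotent zM).
  by congr (_ * _); apply: eq_bigr => r _; rewrite add0n qbinn mul1r.
rewrite qpochSr -mulrA; congr (_ = _): IH; apply: congr1.
set S := (X in _ = _ * X).
(* This is Pascal's rule summed over [r]; the top term of [z * S] vanishes since it contains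
   [z^(M+1) = 0]. *)
suff SE : S = \sum_(r < M.+1) qbin q (m + r) r * z ^+ r + z * q ^+ m.+1 * S.
  by rewrite mulrBl mul1r {1}SE addrK.
have {2}-> : S = \sum_(r < M) qbin q (m.+1 + r) r * z ^+ r +
    qbin q (m.+1 + M) M * z ^+ M by rewrite /S big_ord_recr.
rewrite /S !big_ord_recl !qbin0 -addrA; congr (_ + _).
rewrite mulrDr mulr_sumr [X in _ + (_ + X)](_ : _ = 0); last first.
  by rewrite mulrCA -mulrA (mulrCA z) -exprS zM !mulr0.
rewrite addr0 -big_split /=; apply: eq_bigr => r _.
by rewrite !/bump !add1n !addSn !addnS qbinS subSn ?leq_addl// addnK !exprS; ring.
Qed.

End QIdentities.

(** * Generating functions by number of parts *)

Lemma sum_pairs (V : nmodType) (f : nat -> V) m :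
  \sum_(l < m.*2) f l = \sum_(j < m) (f j.*2 + f j.*2.+1).
Proof.
elim: m => [|m IH]; first by rewrite !big_ord0.
by rewrite doubleS !big_ord_recr IH /= addrA.
Qed.

Lemma sum_even (V : nmodType) (f : nat -> V) n :
  \sum_(0 <= j < n.+1 | ~~ odd j) f j = \sum_(0 <= r < n./2.+1) f r.*2.
Proof.
elim: n => [|n IH]; first by rewrite big_mkcond !big_nat1.
rewrite big_mkcond big_nat_recr//= -big_mkcond IH negbK uphalf_half.
have [on|en] := boolP (odd n); last by rewrite addr0 add0n.
rewrite add1n [RHS]big_nat_recr//=; congr (_ + f _).
by rewrite doubleS -[in LHS](odd_double_half n) on.
Qed.

Section ColumnSeries.
Variables (A : comUnitRingType) (t u : A) (N : nat).
Hypothesis uN : u ^+ N = 0.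
Hypothesis tU : forall i, 1 - t ^+ 2 * t ^+ 2 ^+ i \is a GRing.unit.

Let q := t ^+ 2.
Let z := u ^+ 2 * t ^+ 3.
Let y := (1 - u * t)^-1.
Let Q := qpoch q q.

Let zN : z ^+ N = 0.
Proof. by rewrite /z exprMn -exprM mulnC exprM uN expr0n /= mul0r. Qed.

Let zU i : 1 - z * q ^+ i \is a GRing.unit.
Proof. by apply: (@unitr_1B_nilpotent _ _ N); rewrite exprMn zN mul0r. Qed.

Let QU m : Q m \is a GRing.unit.
Proof. exact: unitr_qpoch. Qed.

(** The series [G_j], the joint contribution of the partitions with [2j] or [2j+1] parts. *)
Definition pair_series j := y * (z ^+ j * q ^+ (j * j.-1) / qpoch q z j) / Q j.

(* The solution F_k of the column recursion. *)
Definition column_series k :=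
  if odd k then u * t ^+ k * pair_series k./2
  else (1 - u * t ^+ k.+1) * pair_series k./2.

Lemma column_series_pair j :
  column_series j.*2 + column_series j.*2.+1 = pair_series j.
Proof.
by rewrite /column_series /= odd_double /= uphalf_double doubleK; ring.
Qed.

(** This is q-Chu-Vandermonde, once [[m,j]_q] is written as [Q m / (Q j * Q (m - j))]. *)
Lemma sum_pair_series m :
  \sum_(j < m.+1) pair_series j / Q (m - j) = y / (Q m * qpoch q z m).
Proof.
rewrite invrM ?unitr_qpoch// -(qchu_vandermonde m zU) mulrA mulr_sumr mulr_suml.
apply: eq_bigr => j _; have jm : (j <= m)%N by rewrite -ltnS.
have bE : qbin q m j = Q m / (Q j * Q (m - j)).
  rewrite -[LHS](mulrK (_ : Q j * Q (m - j) \is a GRing.unit)) ?unitrM ?QU//.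
  by have := qbin_qpoch q (m - j) j; rewrite subnK// => ->.
rewrite bE invrM// -[LHS]mulr1 -(divrr (QU m)) /pair_series; ring.
Qed.

(** By parity of [k]. For [k = 2m+1] the indices [2j] and [2j+1] share the floor [m - j], so they
    pair into [G_j] at once. For [k = 2m] the floors are [m - j] and [m - j - 1], and [l = 2m] is
    left unpaired. Both cases end with [sum_pair_series]. *)
Lemma column_series_rec k : column_series k =
  u ^+ k * t ^+ ((k * k.+1) %/ 2) *
  \sum_(l < k.+1) column_series l / Q ((k - l) %/ 2).
Proof.
have qt m : q ^+ m = t ^+ m.*2 by rewrite /q -exprM mul2n.
have GK m : pair_series m = z ^+ m * q ^+ (m * m.-1) * (y / (Q m * qpoch q z m)).
  by rewrite /pair_series invrM ?unitr_qpoch//; ring.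
have zq m : z ^+ m * q ^+ (m * m.-1) = u ^+ m.*2 * t ^+ (m * m.*2.+1).
  rewrite qt exprMn -!exprM mul2n -mulrA -exprD; congr (_ * t ^+ _).
  by case: m => // m; rewrite /= -!mul2n; nia.
have [[m ->]|[m ->]] : (exists m, k = m.*2) \/ (exists m, k = m.*2.+1).
  rewrite -(odd_double_half k).
  by case: (odd k); [right|left]; exists k./2.
- have -> : ((m.*2 * m.*2.+1) %/ 2 = m * m.*2.+1)%N.
    by rewrite -{1}mul2n -mulnA mulKn.
  rewrite -zq big_ord_recr /= subnn div0n /Q qpoch0 -/Q divr1.
  have -> : \sum_(l < m.*2) column_series l / Q ((m.*2 - l) %/ 2) =
     \sum_(j < m) (column_series j.*2 / Q (m - j) +
                   column_series j.*2.+1 / Q (m - j.+1)).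
    rewrite (sum_pairs (fun l => column_series l / Q ((m.*2 - l) %/ 2))).
    apply: eq_bigr => j _; congr (_ / Q _ + _ / Q _); have := ltn_ord j; lia.
  have -> : column_series m.*2 =
     (1 - u * t ^+ m.*2.+1) * (pair_series m / Q (m - m)).
    by rewrite /column_series odd_double doubleK subnn /Q qpoch0 divr1.
  rewrite (_ : \sum_(j < m) _ =
      \sum_(j < m) (1 - u * t ^+ m.*2.+1) * (pair_series j / Q (m - j))).
    rewrite -mulr_sumr -mulrDr -(big_ord_recr _ (fun j => pair_series j / Q (m - j))).
    by rewrite sum_pair_series subnn /Q qpoch0 -/Q divr1 GK; ring.
  apply: eq_bigr => j _; have jm := ltn_ord j.
  have -> : column_series j.*2 = (1 - u * t ^+ j.*2.+1) * pair_series j.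
    by rewrite /column_series odd_double doubleK.
  have -> : column_series j.*2.+1 = u * t ^+ j.*2.+1 * pair_series j.
    by rewrite /column_series /= odd_double /= uphalf_double.
  (* Over the common denominator [Q (m - j)] the pair has numerator [1 - u t^(2j+1) + u t^(2j+1) (1
     - t^(2m-2j)) = 1 - u t^(2m+1)], which does not depend on [j]. *)
  have -> : (Q (m - j.+1))^-1 = (1 - t ^+ (m.*2 - j.*2)) / Q (m - j).
    have -> : (m - j = (m - j.+1).+1)%N by lia.
    rewrite {2}/Q qpochSr -/Q invrM// -exprS mulrA.
    have -> : t ^+ (m.*2 - j.*2) = q ^+ (m - j.+1).+1.
      by rewrite qt; congr (_ ^+ _); lia.
    by rewrite divrr ?mul1r// exprS.
  have -> : t ^+ m.*2.+1 = t ^+ j.*2.+1 * t ^+ (m.*2 - j.*2).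
    by rewrite -exprD; congr (_ ^+ _); lia.
  ring.
- have -> : ((m.*2.+1 * m.*2.+2) %/ 2 = m * m.*2.+1 + m.*2.+1)%N.
    by rewrite -doubleS -[m.+1.*2]muln2 mulnA mulnK// mulnS mulnC addnC.
  have -> : \sum_(l < m.*2.+2) column_series l / Q ((m.*2.+1 - l) %/ 2) =
     \sum_(j < m.+1) pair_series j / Q (m - j).
    rewrite -doubleS (sum_pairs (fun l => column_series l / Q ((m.*2.+1 - l) %/ 2))).
    apply: eq_bigr => j _; have := ltn_ord j.
    rewrite -column_series_pair mulrDl => jm; congr (_ / Q _ + _ / Q _); lia.
  rewrite sum_pair_series /column_series /= odd_double /= uphalf_double GK zq.
  by rewrite exprD [u ^+ _.+1]exprS; ring.
Qed.

(** The recursion also contains [F k] on its right side, at [l = k], with the nilpotent coefficient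
    [c]. Since [1 - c] is a unit, [F k] is determined by the earlier terms. *)
Lemma column_seriesE (F : nat -> A) : F 0%N = 1 ->
  (forall k, (0 < k)%N -> F k = u ^+ k * t ^+ ((k * k.+1) %/ 2) *
     \sum_(l < k.+1) F l / Q ((k - l) %/ 2)) ->
  F =1 column_series.
Proof.
move=> F0 Frec k; elim/ltn_ind: k => -[|k] IH.
  rewrite F0 /column_series /= /pair_series /= !qpoch0 !expr0 !invr1 !mulr1.
  by rewrite /Q qpoch0 divr1 /y expr1 divrr// (unitr_1B_nilpotent (M := N))// exprMn uN mul0r.
pose c := u ^+ k.+1 * t ^+ ((k.+1 * k.+2) %/ 2).
have cU : 1 - c \is a GRing.unit.
  apply: (@unitr_1B_nilpotent _ _ N).
  by rewrite exprMn -exprM mulnC exprM uN expr0n /= mul0r.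
apply: (mulrI cU); rewrite !mulrBl !mul1r.
rewrite {1}Frec// {1}column_series_rec -/c.
rewrite !(big_ord_recr k.+1) /= subnn /Q qpoch0 !divr1 -!/Q !mulrDr !addrK.
by congr (_ * _); apply: eq_bigr => l _; rewrite IH.
Qed.

(** Both sides equal [1 / (z;q)_(m+1)]. On the left, terms with [j >= N] vanish by nilpotency and
    terms with [j > m + 1] by the Gaussian binomial, so both ranges can be compared with a longer
    one. *)
Lemma sum_qbin_nilpotent m :
  \sum_(j < N) qbin q m.+1 j * (z ^+ j * q ^+ (j * j.-1) / qpoch q z j) =
  \sum_(r < N) qbin q (m + r) r * z ^+ r.
Proof.
rewrite -inv_qpoch_nilpotent// -qchu_vandermonde//.
pose f j := qbin q m.+1 j * (z ^+ j * q ^+ (j * j.-1) / qpoch q z j).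
have aux n1 n2 : (forall j, (n1 <= j)%N -> f j = 0) ->
    \sum_(j < n1 + n2) f j = \sum_(j < n1) f j.
  move=> f0; rewrite big_split_ord /= [X in _ + X]big1 ?addr0// => i _.
  by rewrite f0// leq_addr.
transitivity (\sum_(j < N + m.+2) f j).
  rewrite aux// => j Nj; rewrite /f -(subnK Nj) addnC exprD zN.
  by rewrite !mul0r mulr0.
by rewrite addnC aux// => j mj; rewrite /f qbin_small// mul0r.
Qed.

End ColumnSeries.

(** * Removing the first column *)

Lemma is_intpartP (s : seq nat) : is_intpart s = pairwise geq s && (0%N \notin s).
Proof.
rewrite /is_intpart sorted_pairwise// => x y z /= xy zx.
exact: leq_trans zx xy.
Qed.

Lemma addcol_subproof k (v : intpart) :
  is_intpart ([seq x.+1 | x <- v] ++ nseq (k - size v) 1%N).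
Proof.
case: v => v /=; rewrite !is_intpartP => /andP[v_sorted v_pos].
rewrite pairwise_cat pairwise_map mem_cat negb_or; apply/andP; split.
  apply/and3P; split=> //.
  - by apply/allrelP => _ y /mapP[x _ ->]; rewrite mem_nseq => /andP[_ /eqP->].
  - by elim: (_ - _)%N => //= n ->; rewrite andbT; apply/allP => x;
      rewrite mem_nseq => /andP[_ /eqP->].
by rewrite mem_nseq andbF andbT; apply/negP => /mapP[].
Qed.

(** Puts a column of height [k] in front of the Young diagram, provided that [v] has at most [k]
    parts. *)
Definition addcol k v : intpart := IntPart (addcol_subproof k v).

Lemma delcol_subproof (l : intpart) :
  is_intpart [seq x.-1 | x <- l & (1 < x)%N].
Proof.
case: l => l /=; rewrite !is_intpartP => /andP[l_sorted l_pos].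
rewrite pairwise_map; apply/andP; split.
  apply: sub_pairwise (pairwise_filter _ l_sorted) => x y /=; lia.
by apply/negP => /mapP[x]; rewrite mem_filter => /andP[]; lia.
Qed.

Definition delcol l : intpart := IntPart (delcol_subproof l).

Lemma intpart_gt0 (l : intpart) x : x \in (l : seq nat) -> (0 < x)%N.
Proof.
by case: l => l /= /andP[_ l0]; case: x => // xl; rewrite xl in l0.
Qed.

Lemma addcolK k : cancel (addcol k) delcol.
Proof.
move=> v; apply: val_inj => /=; rewrite filter_cat map_cat.
rewrite [X in _ ++ X](_ : _ = [::]) ?cats0; last first.
  by elim: (_ - _)%N.
have /all_filterP vE : all (preim succn (fun x => 1 < x)%N) v.
  by apply/allP => x /intpart_gt0.
by rewrite filter_map -map_comp vE -[RHS]map_id; apply: eq_map.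
Qed.

Lemma delcolK (l : intpart) : addcol (size l) (delcol l) = l.
Proof.
apply: val_inj => /=; case: l => l /=; rewrite is_intpartP.
elim: l => //= x l IH /andP[/andP[xl l_sorted]].
rewrite inE negb_or => /andP[x0 l0]; case: ifP => x1 /=.
  by rewrite subSS IH ?l_sorted// prednK// ltnW.
have x_eq1 : x = 1%N by lia.
have l1 : all (pred1 1%N) l.
  apply/allP => a al; have /= ax := allP xl a al.
  have a0 : a != 0%N by apply: contraNneq l0 => <-.
  by apply/eqP; lia.
have fl : [seq a <- l | (1 < a)%N] = [::].
  apply/eqP; rewrite -(negbK (_ == _)) -has_filter; apply/hasPn => a al.
  by rewrite (eqP (allP l1 a al)).
by rewrite fl /= x_eq1; congr (_ :: _); apply/esym/all_pred1P.
Qed.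

Lemma size_addcol k (v : intpart) : (size v <= k)%N -> size (addcol k v) = k.
Proof. by move=> vk; rewrite /= size_cat size_map size_nseq subnKC. Qed.

Lemma psize_addcol k (v : intpart) :
  (size v <= k)%N -> psize (addcol k v) = (psize v + k)%N.
Proof.
rewrite /psize /= sumn_cat sumn_nseq mul1n => vk.
suff -> : sumn [seq x.+1 | x <- v] = (sumn v + size v)%N by lia.
by elim: (v : seq nat) => //= x s ->; lia.
Qed.

Lemma size_delcol (l : intpart) : (size (delcol l) <= size l)%N.
Proof. by rewrite /= size_map size_filter count_size. Qed.

(* The partitions of n into exactly k parts; d is fuel, and n <= d suffices. *)
Fixpoint intparts (d n k : nat) : seq intpart :=
  match k, d with
  | 0, _ => if n == 0%N then [:: empty_intpart] else [::]
  | _.+1, 0 => [::]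
  | _.+1, d'.+1 =>
    if (k <= n)%N then
      [seq addcol k v | l <- iota 0 k.+1, v <- intparts d' (n - k)%N l]
    else [::]
  end.

Lemma intpartsS d n k : intparts d.+1 n k.+1 =
  if (k < n)%N then
    [seq addcol k.+1 v | l <- iota 0 k.+2, v <- intparts d (n - k.+1) l]
  else [::].
Proof. by []. Qed.

Lemma intpart_size_le (l : intpart) : (size l <= psize l)%N.
Proof.
have := @intpart_gt0 l; rewrite /psize; elim: (l : seq nat) => //= x s IH sP.
have := sP x (mem_head _ _).
have := IH (fun a As => sP a (mem_behead (s := x :: s) As)); lia.
Qed.

(** A partition with [k > 0] parts is a first column of height [k] followed by a partition of
    [n - k] with at most [k] parts, namely its image under [delcol]. *)
Lemma mem_intparts d n k (l : intpart) : (n <= d)%N ->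
  (l \in intparts d n k) = (psize l == n) && (size l == k).
Proof.
elim: d n k l => [|d IH] n [|k] l nd; rewrite ?intpartsS ?[intparts _ _ 0]/=.
- case: n nd => // _; rewrite inE; apply/eqP/andP => [->//|[_ /nilP l0]].
  exact: val_inj.
- apply/esym/negbTE/negP => /andP[/eqP ln /eqP lk].
  by have := intpart_size_le l; lia.
- case: (eqVneq n 0%N) => [n0|n0].
    rewrite inE; apply/eqP/andP => [->|[_ /nilP l0]]; first by rewrite n0.
    exact: val_inj.
  apply/esym/negbTE/negP => /andP[/eqP ln /nilP lk].
  by move: n0; rewrite -ln /psize lk.
case: ifPn => [kn|kn]; last first.
  apply/esym/negbTE/negP => /andP[/eqP ln /eqP lk].
  by have := intpart_size_le l; lia.
apply/allpairsPdep/andP => [[a [v [+ + ->]]]|[/eqP ln /eqP lk]].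
  rewrite mem_iota ltnS IH => [/= ak /andP[/eqP vn /eqP va]|]; last by lia.
  have vk : (size v <= k.+1)%N by rewrite va.
  by rewrite psize_addcol// size_addcol// vn subnK.
exists (size (delcol l)), (delcol l); rewrite mem_iota ltnS -lk delcolK.
split=> //; first exact: size_delcol.
rewrite IH; last by lia.
rewrite eqxx andbT -ln -{2}(delcolK l) psize_addcol ?size_delcol// addnK//.
Qed.

(** [delcol] recovers [v] from [addcol k v], and the number of parts of [v] recovers the outer
    index. *)
Lemma uniq_intparts d n k : (n <= d)%N -> uniq (intparts d n k).
Proof.
elim: d n k => [|d IH] n [|k] nd; do ?by [|rewrite /=; case: ifP].
rewrite intpartsS.
case: ifPn => // kn; apply: allpairs_uniq_dep.
- exact: iota_uniq.
- by move=> a _; apply: IH; lia.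
move=> _ _ /allpairsPdep[a [v [_ + ->]]] /allpairsPdep[b [w [_ + ->]]] /=.
rewrite !mem_intparts; try lia.
move=> /andP[_ /eqP va] /andP[_ /eqP wb] /(congr1 delcol); rewrite !addcolK => vw.
by move: va wb; rewrite vw => <- <-.
Qed.

Section Weight.
Variable R : fieldType.
Implicit Types t : R.

(** The factor of [pi_part] that remains beside [odd_prod], with [t] for [1/p]. *)
Definition part_weight t (l : intpart) : R :=
  let mu := transpose_part l in
  t ^+ (\sum_(1 <= i < (largest_part l).+1) (mu i * (mu i).+1) %/ 2)%N /
  \prod_(1 <= i < (largest_part l).+1)
     qpoch (t ^+ 2) (t ^+ 2) ((mu i - mu i.+1) %/ 2).

Lemma part_weight_empty t : part_weight t empty_intpart = 1.
Proof. by rewrite /part_weight /largest_part /= !big_geq// expr0 divr1. Qed.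

(** The transpose of [addcol k v] is [k] followed by the transpose of [v], so only the factors at
    [i = 1] are new. *)
Lemma part_weight_addcol t k (v : intpart) : (0 < k)%N -> (size v <= k)%N ->
  part_weight t (addcol k v) = t ^+ ((k * k.+1) %/ 2) /
    qpoch (t ^+ 2) (t ^+ 2) ((k - size v) %/ 2) * part_weight t v.
Proof.
move=> k0 vk.
have mu1 (l : intpart) : transpose_part l 1 = size l.
  by apply/eqP; rewrite -all_count; apply/allP => x /intpart_gt0.
have muS i : transpose_part (addcol k v) i.+2 = transpose_part v i.+1.
  rewrite /transpose_part /= count_cat count_map count_nseq /= addn0.
  by apply: eq_count => x /=.
have lpS : largest_part (addcol k v) = (largest_part v).+1.
  rewrite /largest_part /=; case: (v : seq nat) => //=.
  by rewrite subn0; case: k k0 {vk muS}.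
rewrite /part_weight lpS big_ltn// [\prod_(1 <= i < _.+2) _]big_ltn//.
rewrite !big_add1 /= !mu1 size_addcol// muS mu1.
rewrite invfM exprD mulrACA; congr (_ * (_ ^+ _ / _)).
- by apply: eq_bigr => i _; rewrite muS.
- by apply: eq_bigr => i _; rewrite !muS.
Qed.

Definition size_weight t n k : R := \sum_(l <- intparts n n k) part_weight t l.

Lemma size_weightE t d n k : (n <= d)%N ->
  \sum_(l <- intparts d n k) part_weight t l = size_weight t n k.
Proof.
move=> nd; apply: perm_big; apply: uniq_perm; rewrite ?uniq_intparts// => l.
by rewrite !mem_intparts.
Qed.

Lemma size_weight0 t n : size_weight t n 0 = (n == 0%N)%:R.
Proof.
rewrite /size_weight; case: n => [|n] /=.
  by rewrite big_seq1 part_weight_empty.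
by rewrite big_nil.
Qed.

Lemma size_weight_gt t n k : (n < k)%N -> size_weight t n k = 0.
Proof.
rewrite /size_weight; case: n k => [|n] [|k] //= nk; first by rewrite big_nil.
by rewrite leqNgt nk big_nil.
Qed.

(** Coefficient form of the column recursion: a first column of height [k] is removed, and [l]
    counts the parts of what remains. *)
Lemma size_weight_rec t n k : (0 < k)%N ->
  size_weight t (n + k) k = t ^+ ((k * k.+1) %/ 2) *
    \sum_(l < k.+1) size_weight t n l / qpoch (t ^+ 2) (t ^+ 2) ((k - l) %/ 2).
Proof.
case: k => // k _; rewrite {1}/size_weight addnS.
rewrite intpartsS ltnS leq_addl subSS addnK.
rewrite (@big_allpairs_dep _ _ _ _ (fun _ => intpart)).
rewrite -[iota 0 k.+2]/(index_iota 0 k.+2) big_mkord mulr_sumr.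
apply: eq_bigr => l _.
rewrite -(@size_weightE t (n + k)) ?leq_addr// mulr_suml mulr_sumr.
rewrite big_seq [RHS]big_seq; apply: eq_bigr => v.
rewrite mem_intparts ?leq_addr// => /andP[_ /eqP vl].
have vk : (size v <= k.+1)%N by rewrite vl -ltnS.
by rewrite part_weight_addcol// vl -mulrA [X in _ * X]mulrC.
Qed.

End Weight.

(** * The weight of the partitions of a given size *)

Lemma rmorph_qpoch (A B : comNzRingType) (f : {rmorphism A -> B}) q z n :
  f (qpoch q z n) = qpoch (f q) (f z) n.
Proof.
rewrite /qpoch rmorph_prod; apply: eq_bigr => i _.
by rewrite rmorphB rmorph1 rmorphM rmorphXn.
Qed.

Lemma rmorph_qbin (A B : comUnitRingType) (f : {rmorphism A -> B}) q m j :
  f (qbin q m j) = qbin (f q) m j.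
Proof.
elim: m j => [|m IH] [|j]; rewrite ?qbin0 ?rmorph1//; first exact: rmorph0.
by rewrite !qbinS rmorphD rmorphM rmorphXn !IH.
Qed.

Section QpolyCoef.
Variables (R : fieldType) (n : nat).
Local Notation A := {poly %/ ('X^(n.+1) : {poly R})}.
Local Notation kap := (qpolyC ('X^(n.+1) : {poly R})).
Local Notation u := (qpolyX ('X^(n.+1) : {poly R})).

(** The coefficient of [u^n], the last one that survives modulo [u^(n+1)]. *)
Definition topcoef (x : A) : R := (polyn x)`_n.

Lemma topcoef_sum (I : Type) (s : seq I) (P : pred I) (F : I -> A) :
  topcoef (\sum_(i <- s | P i) F i) = \sum_(i <- s | P i) topcoef (F i).
Proof. exact: coefn_sum. Qed.

Lemma qpolyX_nilpotent : u ^+ n.+1 = 0.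
Proof.
rewrite /qpolyX -rmorphXn; apply: val_inj => /=.
by rewrite mk_monic_Xn /= Pdiv.RingMonic.rmodpp// monicXn.
Qed.

Lemma topcoefZ c x : topcoef (kap c * x) = c * topcoef x.
Proof.
have -> : kap c = c%:A.
  by apply: val_inj; rewrite /= alg_polyC.
by rewrite mulr_algl /topcoef /= coefZ.
Qed.

Lemma topcoefX i : topcoef (u ^+ i) = (i == n)%:R.
Proof.
have [ni|ni] := ltnP n i.
  rewrite -(subnK ni) exprD qpolyX_nilpotent mulr0 /topcoef /= coef0.
  by rewrite gtn_eqF// subnK.
rewrite /qpolyX -rmorphXn /topcoef in_qpoly_small ?coefXn 1?eq_sym//.
by rewrite mk_monic_Xn !size_polyXn ltnS.
Qed.

End QpolyCoef.

(** After a shift of [m] by [j], the Gaussian binomial is [1 / (q;q)_j] times a product of [j]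
    factors, each tending to 1. *)
Lemma cvg_qbin (R : realType) (q : R) j : 0 <= q < 1 ->
  (fun m => qbin q m j) @ \oo --> (qpoch q q j)^-1.
Proof.
move=> /andP[q0 q1].
have qX1 i : q * q ^+ i < 1.
  by rewrite -exprS exprn_ilt1.
have Q0 m : qpoch q q m != 0.
  by apply/prodf_neq0 => i _; rewrite subr_eq0 gt_eqF.
have qbinE m : qbin q (m + j) j =
    (qpoch q q j)^-1 * \prod_(i < j) (1 - q * q ^+ (m + i)).
  apply: (mulIf (mulf_neq0 (Q0 j) (Q0 m))).
  rewrite qbin_qpoch -[RHS]mulrA mulrCA mulKf//.
  by rewrite /qpoch big_split_ord /= mulrC.
have cP : (fun m => \prod_(i < j) (1 - q * q ^+ (m + i))) @ \oo --> (1 : R).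
  elim: j {qbinE} => [|j IH].
    by under eq_fun do rewrite big_ord0; exact: cvg_cst.
  have c1 : (fun m => 1 - geometric (q * q ^+ j) q m) @ \oo --> (1 - 0 : R).
    by apply: cvgB; [exact: cvg_cst|apply: cvg_geometric; rewrite ger0_norm].
  rewrite (_ : (fun m => _) = (fun m => \prod_(i < j) (1 - q * q ^+ (m + i)) *
      (1 - geometric (q * q ^+ j) q m))).
    have := cvgM IH c1; rewrite subr0 mulr1 => H; exact: H.
  apply/funext => m /=; rewrite big_ord_recr /=; congr (_ * (1 - _)).
  by rewrite addnC exprD mulrA.
rewrite -(cvg_shiftn j).
rewrite (_ : [sequence _]_ _ = (fun m => (qpoch q q j)^-1 *
    \prod_(i < j) (1 - q * q ^+ (m + i)))); last exact/funext.
by have := cvgM (cvg_cst (qpoch q q j)^-1) cP; rewrite mulr1 => H; exact: H.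
Qed.

Section SizeWeight.
Variables (R : realType) (t : R) (n : nat).
Variables (A : comUnitRingType) (kap : {rmorphism R -> A}) (u : A) (coef : A -> R).
Hypothesis t01 : 0 < t < 1.
Hypothesis uN : u ^+ n.+1 = 0.
Hypothesis coef_sum : forall (I : Type) (s : seq I) (P : pred I) (F : I -> A),
  coef (\sum_(i <- s | P i) F i) = \sum_(i <- s | P i) coef (F i).
Hypothesis coefZ : forall c x, coef (kap c * x) = c * coef x.
Hypothesis coefXn : forall i, coef (u ^+ i) = (i == n)%:R.

(** The truncated generating functions satisfy the column recursion, hence are the [column_series],
    and their sum is evaluated by a limit. The ring enters only through the nilpotent [u] and the
    linear functional [coef]. *)
Lemma sum_size_weight_coef :
  \sum_(k < n.+1) size_weight t n k =
  \sum_(r < n.+1 | (r.*2 <= n)%N) t ^+ (n + r) / qpoch (t ^+ 2) (t ^+ 2) r.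
Proof.
case/andP: t01 => t0 t1; pose q := t ^+ 2.
have q01 : 0 <= q < 1 by rewrite /q exprn_ge0 ?ltW//= exprn_ilt1 ?ltW.
have Q0 m : qpoch q q m != 0.
  case/andP: q01 => q0 q1; apply/prodf_neq0 => i _.
  by rewrite subr_eq0 gt_eqF// -exprS exprn_ilt1.
have uX0 i : (n < i)%N -> u ^+ i = 0.
  by move=> ni; rewrite -(subnK ni) exprD uN mulr0.
have coefX c i : coef (kap c * u ^+ i) = c * (i == n)%:R by rewrite coefZ coefXn.
have kapV c : c != 0 -> (kap c)^-1 = kap c^-1.
  by move=> c0; rewrite rmorphV// unitfE.
have kapQ m : qpoch (kap t ^+ 2) (kap t ^+ 2) m = kap (qpoch q q m).
  by rewrite rmorph_qpoch rmorphXn.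
have tU i : 1 - kap t ^+ 2 * kap t ^+ 2 ^+ i \is a GRing.unit.
  rewrite -!rmorphXn -rmorphM -(rmorph1 kap) -rmorphB rmorph_unit// unitfE.
  case/andP: q01 => q0 q1.
  by rewrite subr_eq0 gt_eqF// -exprS exprn_ilt1.
pose F k := \sum_(i < n.+1) kap (size_weight t i k) * u ^+ i.
have coefF k : coef (F k) = size_weight t n k.
  rewrite /F coef_sum big_ord_recr /= coefX eqxx mulr1 big1 ?add0r// => i _.
  by rewrite coefX (ltn_eqF (ltn_ord i)) mulr0.
have F0 : F 0%N = 1.
  rewrite /F big_ord_recl big1 => [|i _]; last first.
    by rewrite size_weight0 /= rmorph0 mul0r.
  by rewrite size_weight0 /= rmorph1 mul1r addr0.
have Frec k : (0 < k)%N -> F k = u ^+ k * kap t ^+ ((k * k.+1) %/ 2) *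
     \sum_(l < k.+1) F l / qpoch (kap t ^+ 2) (kap t ^+ 2) ((k - l) %/ 2).
  (* Terms beyond [n] vanish because [u^(n+1) = 0], and the first [k] because a partition with [k]
     parts has size at least [k]. The shift by [k] produces the factor [u^k]. *)
  move=> k0; transitivity (\sum_(i < k + n.+1) kap (size_weight t i k) * u ^+ i).
    rewrite addnC big_split_ord /= [X in _ + X]big1 ?addr0// => i _.
    by rewrite uX0 ?mulr0// ltnS leq_addr.
  rewrite big_split_ord /= big1 => [|i _]; last first.
    by rewrite size_weight_gt// rmorph0 mul0r.
  rewrite add0r.
  under eq_bigr => i _.
    rewrite addnC size_weight_rec// rmorphM rmorphXn rmorph_sum exprD /=.
    over.
  rewrite mulr_sumr /F.
  under [RHS]eq_bigr => l _ do rewrite mulr_suml mulr_sumr.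
  rewrite exchange_big /=; apply: eq_bigr => i _.
  rewrite mulr_sumr mulr_suml; apply: eq_bigr => l _.
  by rewrite rmorphM kapQ kapV//; ring.
have FE := column_seriesE uN tU F0 Frec.
pose y := (1 - u * kap t)^-1.
pose z := u ^+ 2 * kap t ^+ 3.
pose T j := z ^+ j * kap t ^+ 2 ^+ (j * j.-1) / qpoch (kap t ^+ 2) z j.
have pairE j : pair_series (kap t) u j = kap (qpoch q q j)^-1 * (y * T j).
  by rewrite /pair_series kapQ kapV// mulrC.
have lhsE : \sum_(k < n.+1) size_weight t n k =
    \sum_(j < n.+1) (qpoch q q j)^-1 * coef (y * T j).
  (* The range is padded with zero terms to even length, so that the [column_series] pair up. *)
  transitivity (\sum_(k < n.+1.*2) size_weight t n k).
    rewrite -addnn big_split_ord /= [X in _ = _ + X]big1 ?addr0// => k _.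
    by rewrite size_weight_gt// ltnS leq_addr.
  under eq_bigr do rewrite -coefF FE.
  rewrite -coef_sum sum_pairs coef_sum; apply: eq_bigr => j _.
  by rewrite column_series_pair pairE coefZ.
(* In the geometric expansion of [y] only [i = n - 2r] reaches degree [n], and the power of [t] is
   then [(n - 2r) + 3r = n + r]. *)
have coefyz r : coef (y * z ^+ r) = if (r.*2 <= n)%N then t ^+ (n + r) else 0.
  have uk : (u * kap t) ^+ n.+1 = 0 by rewrite exprMn uN mul0r.
  have -> : y = \sum_(i < n.+1) (u * kap t) ^+ i.
    apply: (mulrI (unitr_1B_nilpotent uk)).
    by rewrite sum_expr_nilpotent// divrr// (unitr_1B_nilpotent uk).
  rewrite mulr_suml coef_sum.
  have cE (i : 'I_n.+1) : coef ((u * kap t) ^+ i * z ^+ r) =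
      t ^+ (i + 3 * r)%N * (i + r.*2 == n)%N%:R.
    rewrite -coefX; congr coef.
    by rewrite /z exprMn [(u ^+ 2 * _) ^+ r]exprMn -!exprM rmorphXn -mul2n !exprD; ring.
  under eq_bigr do rewrite cE.
  case: ifPn => rn.
    rewrite (bigD1 (inord (n - r.*2))) //= inordK ?ltnS ?leq_subr//.
    rewrite subnK// eqxx mulr1 big1 ?addr0 => [|i].
      by congr (_ ^+ _); lia.
    rewrite -val_eqE /= inordK ?ltnS ?leq_subr// => ni.
    rewrite [_ == _](_ : _ = false) ?mulr0//; apply/negbTE.
    by apply: contra ni => /eqP E; apply/eqP; lia.
  rewrite big1// => i _; rewrite [_ == _](_ : _ = false) ?mulr0//.
  by apply/negbTE; apply: contra rn => /eqP E; lia.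
(* The Gaussian binomials are scalars, so [coef] turns the identity in [A] into one in [R] for every
   [m]. *)
have id m : \sum_(j < n.+1) qbin q m.+1 j * coef (y * T j) =
    \sum_(r < n.+1) qbin q (m + r) r * coef (y * z ^+ r).
  have /(congr1 (fun x => coef (y * x))) := sum_qbin_nilpotent (kap t) uN m.
  rewrite -/z !mulr_sumr !coef_sum => E.
  transitivity (\sum_(i < n.+1) coef (y * (qbin (kap t ^+ 2) m.+1 i * T i))).
    by apply: eq_bigr => i _; rewrite -coefZ rmorph_qbin rmorphXn mulrCA.
  rewrite E; apply: eq_bigr => i _.
  by rewrite -coefZ rmorph_qbin rmorphXn mulrCA.
rewrite lhsE [RHS]big_mkcond /=.
(* As [m] tends to infinity, each Gaussian binomial on either side of [id] tends to the inverse of a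
   q-Pochhammer symbol; uniqueness of limits equates the two sums. *)
have cl : (fun m => \sum_(j < n.+1) qbin q m.+1 j * coef (y * T j)) @ \oo -->
    \sum_(j < n.+1) (qpoch q q j)^-1 * coef (y * T j).
  apply: cvg_big => [|j _]; [exact: add_continuous|apply: cvgM; last exact: cvg_cst].
  have := @cvg_qbin _ q j q01; rewrite -(cvg_shiftn 1).
  by under eq_fun do rewrite addn1.
have cr : (fun m => \sum_(r < n.+1) qbin q (m + r) r * coef (y * z ^+ r)) @ \oo -->
    \sum_(r < n.+1) (qpoch q q r)^-1 * coef (y * z ^+ r).
  apply: cvg_big => [|r _]; [exact: add_continuous|apply: cvgM; last exact: cvg_cst].
  by have := @cvg_qbin _ q r q01; rewrite -(cvg_shiftn r).
have {}cl : (fun m => \sum_(r < n.+1) qbin q (m + r) r * coef (y * z ^+ r)) @ \oo -->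
    \sum_(j < n.+1) (qpoch q q j)^-1 * coef (y * T j).
  by move: cl; under eq_fun do rewrite id.
rewrite (cvg_unique (@Rhausdorff R) cl cr).
by apply: eq_bigr => r _; rewrite coefyz; case: ifP; rewrite ?mulr0// mulrC.
Qed.

End SizeWeight.

Lemma sum_size_weight (R : realType) (t : R) n : 0 < t < 1 ->
  \sum_(k < n.+1) size_weight t n k =
  \sum_(r < n.+1 | (r.*2 <= n)%N) t ^+ (n + r) / qpoch (t ^+ 2) (t ^+ 2) r.
Proof.
move=> t01.
exact: (@sum_size_weight_coef R t n _ (qpolyC ('X^(n.+1) : {poly R}))
  (qpolyX _) (@topcoef R n) t01 (qpolyX_nilpotent R n) (@topcoef_sum R n)
  (@topcoefZ R n) (@topcoefX R n)).
Qed.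

(** * Euler's identity and the total mass *)

Section EulerSeries.
Variables (R : realType) (q : R).
Hypothesis q01 : 0 <= q < 1.

Implicit Types z : R.

Let q_ge0 : 0 <= q. Proof. by case/andP: q01. Qed.
Let q_lt1 : q < 1. Proof. by case/andP: q01. Qed.

Definition euler_term (z : R) (r : nat) : R := z ^+ r / qpoch q q r.

(** Every factor is at least [1 - q]. This bounds the Euler series by a geometric series of ratio
    [z / (1 - q)], whence the condition on that ratio below. *)
Lemma qpoch_ge r : (1 - q) ^+ r <= qpoch q q r.
Proof.
rewrite /qpoch -[X in _ ^+ X]card_ord -prodr_const; apply: ler_prod => i _.
by rewrite subr_ge0 ltW//= lerB// ler_piMr// exprn_ile1// ltW.
Qed.

Lemma qpoch_gt0 r : 0 < qpoch q q r.
Proof. by apply: lt_le_trans (qpoch_ge r); rewrite exprn_gt0// subr_gt0. Qed.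

Lemma euler_term_ge0 z r : 0 <= z -> 0 <= euler_term z r.
Proof. by move=> z0; rewrite divr_ge0 ?exprn_ge0// ltW// qpoch_gt0. Qed.

Lemma euler_term_le z r : 0 <= z -> euler_term z r <= (z / (1 - q)) ^+ r.
Proof.
move=> z0; rewrite expr_div_n ler_wpM2l ?exprn_ge0//.
by rewrite lef_pV2 ?qpoch_ge// posrE ?qpoch_gt0// exprn_gt0// subr_gt0.
Qed.

Lemma is_cvg_euler z : 0 <= z -> z / (1 - q) < 1 ->
  cvgn (series (euler_term z)).
Proof.
move=> z0 z1; apply: (@series_le_cvg _ _ (geometric 1 (z / (1 - q)))).
- by move=> r; exact: euler_term_ge0.
- by move=> r; rewrite /= mul1r exprn_ge0// divr_ge0// subr_ge0 ltW.
- by move=> r; rewrite /= mul1r euler_term_le.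
apply: is_cvg_geometric_series.
by rewrite ger0_norm// divr_ge0// subr_ge0 ltW.
Qed.

Definition euler z := limn (series (euler_term z)).

Lemma euler_ge1 z : 0 <= z -> z / (1 - q) < 1 -> 1 <= euler z.
Proof.
move=> z0 z1; apply: limr_ge; first exact: is_cvg_euler.
near=> N.
have N0 : (0 < N)%N by near: N; exists 1%N.
rewrite /series /= big_ltn// {1}/euler_term expr0 /qpoch big_ord0 divr1.
by rewrite lerDl sumr_ge0// => i _; exact: euler_term_ge0.
Unshelve. all: by end_near. Qed.

Lemma euler_le z : 0 <= z -> z / (1 - q) < 1 -> euler z <= (1 - z / (1 - q))^-1.
Proof.
move=> z0 z1.
have w0 : 0 <= z / (1 - q) by rewrite divr_ge0// subr_ge0 ltW.
have cg : series (geometric 1 (z / (1 - q))) @ \oo --> 1 * (1 - z / (1 - q))^-1.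
  by apply: cvg_geometric_series; rewrite ger0_norm.
rewrite -[leRHS]mul1r -(cvg_lim _ cg)//; apply: ler_lim.
- exact: is_cvg_euler.
- exact: cvgP cg.
by apply: nearW => N; apply: ler_sum => i _; rewrite /= mul1r euler_term_le.
Qed.

(** In the difference of the two series, the numerator [z^(r+1) (1 - q^(r+1))] cancels the last
    factor of [(q;q)_(r+1)], which leaves [e(z) - e(z q) = z e(z)]. *)
Lemma euler_rec z : 0 <= z -> z / (1 - q) < 1 ->
  euler z * (1 - z) = euler (z * q).
Proof.
move=> z0 z1.
have zq1 : z * q / (1 - q) < 1.
  by rewrite mulrAC (le_lt_trans _ z1)// ler_piMr ?divr_ge0 ?subr_ge0 ?(ltW q_lt1).
have cz := is_cvg_euler z0 z1.
have czq := is_cvg_euler (mulr_ge0 z0 q_ge0) zq1.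
have stepE N : series (euler_term z) N.+1 - series (euler_term (z * q)) N.+1 =
    z * series (euler_term z) N.
  rewrite /series /= -sumrB big_nat_recl//.
  rewrite {1 2}/euler_term !expr0 subrr add0r mulr_sumr.
  apply: eq_bigr => r _; rewrite /euler_term qpochSr -exprS.
  have Q0 := gt_eqF (qpoch_gt0 r).
  have q1 : 1 - q ^+ r.+1 != 0.
    by rewrite subr_eq0 gt_eqF// exprn_ilt1.
  rewrite exprMn exprS; field.
  by rewrite q1 Q0.
have c1 : (fun N => series (euler_term z) N.+1 - series (euler_term (z * q)) N.+1)
    @ \oo --> euler z - euler (z * q).
  by apply: cvgB; rewrite cvg_shiftS.
have c2 : (fun N => z * series (euler_term z) N) @ \oo --> z * euler z.
  by apply: cvgM => //; exact: cvg_cst.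
move: c1; under eq_fun do rewrite stepE.
move=> c1; have := cvg_unique (@Rhausdorff R) c1 c2.
by move=> E; rewrite mulrBr mulr1 (mulrC _ z) -E; ring.
Qed.

Lemma euler_qpoch z N : 0 <= z -> z / (1 - q) < 1 ->
  euler z * qpoch q z N = euler (z * q ^+ N).
Proof.
move=> z0 z1; elim: N => [|N IH]; first by rewrite qpoch0 expr0 !mulr1.
rewrite qpochSr mulrA IH exprSr mulrA euler_rec ?mulr_ge0 ?exprn_ge0//.
rewrite mulrAC (le_lt_trans _ z1)// ler_piMr ?exprn_ile1 ?(ltW q_lt1)//.
by rewrite divr_ge0// subr_ge0 ltW.
Qed.

(** The product is [e(z q^N)], squeezed between 1 and [1 / (1 - w q^N)] with [w = z / (1 - q)]. *)
Lemma cvg_euler_qpoch z : 0 <= z -> z / (1 - q) < 1 ->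
  (fun N => euler z * qpoch q z N) @ \oo --> (1 : R).
Proof.
move=> z0 z1; pose w := z / (1 - q).
have w0 : 0 <= w by rewrite divr_ge0// subr_ge0 ltW.
have zN N : 0 <= z * q ^+ N by rewrite mulr_ge0// exprn_ge0.
have wE N : z * q ^+ N / (1 - q) = geometric w q N by rewrite mulrAC.
have wN N : z * q ^+ N / (1 - q) < 1.
  by rewrite wE /= (le_lt_trans _ z1)// ler_piMr// exprn_ile1// ltW.
under eq_fun do rewrite euler_qpoch//.
apply: (@squeeze_cvgr _ _ _ _ (cst 1) (fun N => (1 - geometric w q N)^-1)).
- by apply: nearW => N; rewrite -wE euler_ge1//= euler_le.
- exact: cvg_cst.
have c : (fun N => 1 - geometric w q N) @ \oo --> (1 - 0 : R).
  by apply: cvgB; [exact: cvg_cst|apply: cvg_geometric; rewrite ger0_norm].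
have := cvgV _ c; rewrite subr0 invr1 => H; apply: H; exact: oner_neq0.
Qed.

End EulerSeries.

Lemma sqr_half_le (R : realType) (t : R) :
  0 < t -> t <= 2^-1 -> t ^+ 2 <= 4^-1.
Proof.
move=> t0 t2; rewrite expr2.
by apply: (le_trans (ler_pM (ltW t0) (ltW t0) t2 t2)); lra.
Qed.

Lemma sqr_half_lt1 (R : realType) (t : R) :
  0 < t -> t <= 2^-1 -> 0 <= t ^+ 2 < 1.
Proof.
by move=> t0 t2; rewrite sqr_ge0 (le_lt_trans (sqr_half_le t0 t2))//; lra.
Qed.

(** The ratio is at most [(1/2) / (3/4) = 2/3]; the extreme case is [p = 2]. *)
Lemma half_ratio_lt1 (R : realType) (t : R) :
  0 < t -> t <= 2^-1 -> t / (1 - t ^+ 2) < 1.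
Proof.
move=> t0 t2; have := sqr_half_le t0 t2; move: (t ^+ 2) => y y4.
by rewrite ltr_pdivrMr; move: t2 y4; lra.
Qed.

Section TotalMass.
Variables (R : realType) (t : R).
Let q := t ^+ 2.

Definition size_mass n : R :=
  \sum_(r < n.+1 | (r.*2 <= n)%N) t ^+ (n + r) / qpoch q q r.

Lemma size_massE n :
  size_mass n = t ^+ n * series (euler_term q t) n./2.+1.
Proof.
rewrite /size_mass /series /= big_mkord mulr_sumr.
rewrite (big_ord_widen_cond n.+1 xpredT (fun r => t ^+ n * euler_term q t r)); last first.
  by lia.
apply: eq_big => [r|r _]; first by rewrite /=; apply/idP/idP; lia.
by rewrite exprD mulrA.
Qed.

(** Finite form of exchanging the sums over [n] and [r]: the geometric sum over [2r <= n < N], times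
    [1 - t], is [t^(2r) - t^N], and [uphalf N] counts the [r] with [2r < N]. *)
Lemma sum_size_mass N : (1 - t) * \sum_(0 <= n < N) size_mass n =
  series (euler_term q (t * q)) (uphalf N) - t ^+ N * series (euler_term q t) (uphalf N).
Proof.
elim: N => [|N IH].
  by rewrite /series /= !big_geq// !mulr0 subr0.
rewrite big_nat_recr//= mulrDr IH size_massE.
(* A new index [r = N/2] enters only for even [N]; its two contributions cancel because
   [t^N = q^r]. *)
have [oN|eN] := boolP (odd N).
  have -> : uphalf N = N./2.+1 by rewrite uphalf_half oN.
  by rewrite exprS; ring.
have uN : uphalf N = N./2 by rewrite uphalf_half (negbTE eN).
have NE : N = N./2.*2 by rewrite -[LHS]odd_double_half (negbTE eN).
rewrite uN /series /= !(big_nat_recr N./2)//=.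
have -> : euler_term q (t * q) N./2 = t ^+ N * euler_term q t N./2.
  have -> : t ^+ N = q ^+ N./2 by rewrite [in LHS]NE /q -exprM mul2n.
  by rewrite /euler_term exprMn; ring.
by rewrite exprS; ring.
Qed.

Hypothesis t0 : 0 < t.
Hypothesis t2 : t <= 2^-1.

Let t_lt1 : t < 1.
Proof. by move: t2; lra. Qed.

Let q01 : 0 <= q < 1 := sqr_half_lt1 t0 t2.
Let t_small : t / (1 - q) < 1 := half_ratio_lt1 t0 t2.

(** The limit of the closed form is [e(t q) / (1 - t)], which is [e(t)] by the functional
    equation. *)
Lemma cvg_sum_size_mass : series size_mass @ \oo --> euler q t.
Proof.
have tq_small : t * q / (1 - q) < 1.
  case/andP: q01 => q0 q1.
  by rewrite mulrAC (le_lt_trans _ t_small)// ler_piMr ?ltW// divr_gt0// subr_gt0.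
have tq0 : 0 <= t * q by case/andP: q01 => q0 _; rewrite mulr_ge0// ltW.
have up : uphalf @ \oo --> \oo.
  by apply/cvgnyPge => B; exists B.*2 => // N /= BN; lia.
have c1 := cvg_comp _ _ up (is_cvg_euler q01 tq0 tq_small).
have c2 := cvg_comp _ _ up (is_cvg_euler q01 (ltW t0) t_small).
have tN : (fun N => t ^+ N) @ \oo --> (0 : R).
  by apply: cvg_expr; rewrite ger0_norm ?(ltW t0).
have c := cvgM (cvg_cst (1 - t)^-1) (cvgB c1 (cvgM tN c2)).
have t1 : 1 - t != 0 by rewrite subr_eq0 gt_eqF.
have -> : euler q t = (1 - t)^-1 * (euler q (t * q) - 0 * euler q t).
  by rewrite -(euler_rec q01 (ltW t0) t_small); field.
rewrite (_ : series size_mass = (fun N => (1 - t)^-1 *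
   (series (euler_term q (t * q)) (uphalf N) -
    t ^+ N * series (euler_term q t) (uphalf N)))); first exact: c.
by apply/funext => N; rewrite -sum_size_mass mulKf.
Qed.

End TotalMass.

(** * Measures on partitions with prescribed point masses *)

Section EsumMeasure.
Variables (R : realType) (w : intpart -> {nonneg R}).
Local Open Scope ereal_scope.

Definition esum_measure (A : set intpart) : \bar R :=
  \esum_(l in A) ((w l)%:num)%:E.

Let esum_measure0 : esum_measure set0 = 0.
Proof. exact: esum_set0. Qed.

Let esum_measure_ge0 A : 0 <= esum_measure A.
Proof. by apply: esum_ge0 => l _; rewrite lee_fin. Qed.

Let esum_measure_sigma_additive : semi_sigma_additive esum_measure.
Proof.
move=> F _ tF _; rewrite /esum_measure nneseries_sum_bigcup//.
by apply: is_cvg_nneseries => n _ _; exact: esum_measure_ge0.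
Qed.

HB.instance Definition _ := isMeasure.Build default_measure_display intpart R
  esum_measure esum_measure0 esum_measure_ge0 esum_measure_sigma_additive.

Lemma esum_measure_set1 l : esum_measure [set l] = ((w l)%:num)%:E.
Proof. by rewrite /esum_measure esum_set1// lee_fin. Qed.

Lemma esum_measure_size n : esum_measure [set l | psize l = n] =
  (\sum_(k < n.+1) \sum_(l <- intparts n n k) (w l)%:num)%:E.
Proof.
pose s := [seq l | k <- iota 0 n.+1, l <- intparts n n k].
have sE : [set l | psize l = n] = [set` s].
  apply/seteqP; split=> l /=.
    move=> ln; apply/allpairsPdep; exists (size l), l.
    by rewrite mem_iota mem_intparts// ln !eqxx /= ltnS -ln intpart_size_le.
  move=> /allpairsPdep[k [l' [_ + ->]]].
  by rewrite mem_intparts// => /andP[/eqP].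
have us : uniq s.
  apply: allpairs_uniq_dep => [|k _|]; rewrite ?iota_uniq ?uniq_intparts//.
  move=> _ _ /allpairsPdep[a [v [_ + ->]]] /allpairsPdep[b [v' [_ + ->]]] /=.
  rewrite !mem_intparts// => /andP[_ /eqP va] /andP[_ /eqP wb] vv.
  by move: va wb; rewrite vv => <- <-.
rewrite /esum_measure sE esum_fset; [|exact: finite_seq|by []].
rewrite -fsbig_seq// sumEFin /s; congr _%:E.
rewrite (@big_allpairs_dep _ _ _ _ (fun _ => intpart)).
by rewrite -[iota 0 n.+1]/(index_iota 0 n.+1) big_mkord.
Qed.

(** The size classes partition the whole space, so the total mass becomes a series over [n]. *)
Lemma esum_measureT :
  esum_measure setT = \sum_(0 <= n <oo) esum_measure [set l | psize l = n].
Proof.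
rewrite /esum_measure -nneseries_sum_bigcup//.
- by congr esum; apply/seteqP; split=> // l _; exists (psize l).
- by move=> i j _ _ [l [/= <- <-]].
Qed.

End EsumMeasure.

(** * The case [t = 1/p] *)

Section PrimeParameter.
Variables (R : realType) (p : nat).
Hypothesis p_prime : prime p.
Local Notation t := ((p%:R : R)^-1).
Local Notation q := (t ^+ 2).

Let p0 : (0 : R) < p%:R.
Proof. by rewrite ltr0n prime_gt0. Qed.

Let t0 : 0 < t.
Proof. by rewrite invr_gt0. Qed.

Let t2 : t <= 2^-1.
Proof. by rewrite lef_pV2 ?posrE// ler_nat prime_gt1. Qed.

Let t01 : 0 < t < 1.
Proof. by rewrite t0 (le_lt_trans t2)//; lra. Qed.

Let q01 := sqr_half_lt1 t0 t2.
Let t_small := half_ratio_lt1 t0 t2.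

(** The odd exponents up to [2N] are [2i+1] with [i < N], and [t^(2i+1) = t q^i]. *)
Lemma odd_partial_prodE N : odd_partial_prod R p N.*2.+1 = qpoch q t N.
Proof.
rewrite /odd_partial_prod; elim: N => [|N IH].
  by rewrite big_geq// qpoch0.
rewrite doubleS big_mkcond 2?big_nat_recr//= odd_double/= -big_mkcond IH mulr1.
by rewrite qpochSr -exprM mul2n -exprS !exprVn div1r.
Qed.

Lemma even_prodE N :
  \prod_(1 <= i < N.*2.+1 | ~~ odd i) (1 - 1 / p%:R ^+ i) = qpoch q q N :> R.
Proof.
elim: N => [|N IH]; first by rewrite big_geq// qpoch0.
rewrite doubleS big_mkcond 2?big_nat_recr//= odd_double/= -big_mkcond IH mulr1.
by rewrite qpochSr -exprS -exprM mul2n doubleS !exprVn div1r.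
Qed.

(** Euler's identity at [z = t]: along the indices [2N+1] the partial odd products are [(t;q)_N], so
    [odd_prod] is [(t;q)_oo]. *)
Lemma euler_odd_prod : euler q t * odd_prod R p = 1.
Proof.
have dbl : (fun N => N.*2.+1) @ \oo --> \oo.
  by apply/cvgnyPge => B; exists B => // N /= BN; lia.
have c1 := cvg_comp _ _ dbl (@is_cvg_odd_partial_prod R p p_prime).
have c2 : (fun N => euler q t * qpoch q t N) @ \oo --> euler q t * odd_prod R p.
  apply: cvgM; first exact: cvg_cst.
  have -> : qpoch q t = odd_partial_prod R p \o (fun N => N.*2.+1).
    by apply/funext => N; rewrite /= odd_partial_prodE.
  exact: c1.
exact: (cvg_unique (@Rhausdorff R) c2 (cvg_euler_qpoch q01 (ltW t0) t_small)).
Qed.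

(** It is the inverse of [e(t)], which is at least 1. *)
Lemma odd_prod_ge0 : 0 <= odd_prod R p.
Proof.
have e1 := euler_ge1 q01 (ltW t0) t_small.
have e0 : 0 < euler q t by apply: lt_le_trans e1.
by rewrite -(pmulr_rge0 _ e0) euler_odd_prod.
Qed.

Lemma pi_partE l : pi_part R p l = odd_prod R p * part_weight t l.
Proof.
rewrite /pi_part /part_weight; congr (_ * _); rewrite invfM exprVn.
congr (_ * _^-1); apply: eq_bigr => i _.
rewrite /qpoch big_add1 /= big_mkord; apply: eq_bigr => j _.
by rewrite -exprS -exprM !exprVn div1r.
Qed.

Lemma pi_part_ge0 l : 0 <= pi_part R p l.
Proof.
rewrite pi_partE mulr_ge0 ?odd_prod_ge0// divr_ge0 ?exprn_ge0 ?(ltW t0)//.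
by apply: prodr_ge0 => i _; rewrite ltW// qpoch_gt0.
Qed.

Definition pi_nonneg (l : intpart) : {nonneg R} := NngNum (pi_part_ge0 l).

Lemma pi_size n : esum_measure pi_nonneg [set l | psize l = n] =
  (odd_prod R p * size_mass t n)%:E.
Proof.
rewrite esum_measure_size; congr _%:E.
rewrite /size_mass -sum_size_weight// mulr_sumr; apply: eq_bigr => k _.
by rewrite mulr_sumr; apply: eq_bigr => l _; rewrite /= pi_partE.
Qed.

Lemma size_mass_even n : size_mass t n = (p%:R ^+ n)^-1 *
  \sum_(0 <= j < n.+1 | ~~ odd j)
     1 / (p%:R ^+ (j %/ 2) *
          \prod_(1 <= i < j.+1 | ~~ odd i) (1 - 1 / p%:R ^+ i)).
Proof.
rewrite sum_even size_massE exprVn; congr (_ * _); apply: eq_bigr => r _.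
by rewrite even_prodE divn2 doubleK /euler_term invfM mul1r !exprVn.
Qed.

Lemma pi_total : esum_measure pi_nonneg setT = 1%E.
Proof.
rewrite esum_measureT; under eq_eseriesr do rewrite pi_size.
apply: cvg_lim => //.
have c : (fun N => odd_prod R p * series (size_mass t) N) @ \oo -->
    odd_prod R p * euler q t.
  by apply: cvgM; [exact: cvg_cst|exact: cvg_sum_size_mass].
have oe : odd_prod R p * euler q t = 1 by rewrite mulrC euler_odd_prod.
rewrite oe in c.
rewrite [X in X @ _](_ : _ =
  EFin \o (fun N => odd_prod R p * series (size_mass t) N)).
  by apply: cvg_EFin; [exact: nearW|exact: c].
by apply/funext => N /=; rewrite sumEFin -mulr_sumr.
Qed.

HB.instance Definition _ := Measure_isProbability.Build _ _ _
  (esum_measure pi_nonneg) pi_total.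

End PrimeParameter.

Unset Implicit Arguments.

Theorem theorem2p1 (R : realType) (p : nat) (p_prime : prime p) :
  exists P : probability intpart R,
    (forall l : intpart, P [set l] = (pi_part R p l)%:E) /\
    (forall n : nat,
      P [set l : intpart | psize l = n] =
      (odd_prod R p / p%:R ^+ n *
       \sum_(0 <= j < n.+1 | ~~ odd j)
         1 / (p%:R ^+ (j %/ 2) *
              \prod_(1 <= i < j.+1 | ~~ odd i) (1 - 1 / p%:R ^+ i)))%:E).
Proof.
exists (esum_measure (pi_nonneg R p_prime) : probability _ _).
split=> [l|n]; first exact: esum_measure_set1.
by apply: etrans (pi_size R p_prime n) _; rewrite size_mass_even mulrA.
Qed.
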